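(* Let $\rho$ be an integer, and let $z_{1,0},\dots,z_{n,0}$ be fixed (pairwise distinct) points. For $1\le i\le n$ let $W_i(\mu_{i-1},\xi_i)$ be the $n\times n$ matrix function of $\xi_i=(z_i,\dots,z_n)$ satisfying $$\frac{\partial}{\partial z_i}W_i(\mu_{i-1},\xi_i)=\rho A_i(\mu_{i-1},\xi_i)W_i(\mu_{i-1},\xi_i),\qquad W_i(\mu_{i-1},\xi_i)\big|_{z_i=z_{i,0}}=I_n .$$ Then the $n\times n$ matrix function $$W(z)=W_1(z)\,W_2(z_{1,0},\xi_2)\cdots W_n(\mu_{n-1},z_n)$$ is a fundamental rational solution of the Knizhnik–Zamolodchikov system $$\frac{\partial W}{\partial z_j}=\rho A_j(z_1,\dots,z_n)W,\qquad 1\le j\le n .$$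
   Context: $z=(z_1,\dots,z_n)$ are complex variables with $z_k\neq z_\ell$ for $k\neq \ell$, and $$A_j(z_1,\dots,z_n)=\sum_{k=1,\,k\ne j}^{n}\frac{P_{j,k}}{z_j-z_k}.$$ For $i\ne j$, $P_{i,j}=P_{j,i}$ is the $n\times n$ permutation matrix of the transposition $(i;j)$ in the natural representation of the symmetric group $S_n$: its $(i,j)$ and $(j,i)$ entries are $1$, its $(k,k)$ entries are $1$ for $k\ne i,j$, and all other entries are $0$. Notation: $\mu_i=(z_{1,0},\dots,z_{i,0})$ ($\mu_0$ is empty, so $W_1(\mu_0,\xi_1)=W_1(z)$) and $\xi_i=(z_i,\dots,z_n)$; $A_i(\mu_{i-1},\xi_i)$ means $A_i$ with the first $i-1$ variables set equal to $z_{1,0},\dots,z_{i-1,0}$. Each $W_i$ is uniquely determined near $(z_{i,0},\dots,z_{n,0})$ by the stated equation and normalization. A fundamental rational solution is an $n\times n$ matrix solution with entries rational in $z_1,\dots,z_n$ and with linearly independent columns. *)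

(* Defs.v *)
(* MathComp / MathComp-Analysis; complex numbers are R[i] for R : realType. *)
From HB Require Import structures.
From mathcomp Require Import all_boot all_order all_algebra.
From mathcomp Require Import all_classical all_reals all_analysis.
From mathcomp Require Import complex.
(* The notations of mpoly clash with those of MathComp-Analysis: only its
   canonical structures are imported. *)
From mathcomp Require mpoly.
Import (canonicals, coercions) mpoly.

Set Implicit Arguments.
Unset Strict Implicit.
Unset Printing Implicit Defensive.

Import Order.TTheory GRing.Theory Num.Theory.
Import numFieldNormedType.Exports.

Local Open Scope ring_scope.
Local Open Scope classical_set_scope.

(* Going through a numeric-field instance gives R[i] (and matrices over it) the
   topology of the complex modulus, and makes is_derive complex
   differentiation: the increment h ranges over complex numbers. *)
Definition Cplx (R : realType) : numClosedFieldType := complex R.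

(* Points of C^n are row vectors, and indices run over 0, ..., n-1. *)
Definition distinct_coords (R : realType) (n : nat) (z : 'rV[Cplx R]_n) : Prop :=
  injective (fun k : 'I_n => z 0 k).

Definition KZ_A (R : realType) (n : nat) (j : 'I_n) (z : 'rV[Cplx R]_n) :
    'M[Cplx R]_n :=
  \sum_(k < n | k != j) (z 0 j - z 0 k)^-1 *: tperm_mx j k.

(* The point (mu_{i-1}, xi_i): the variables before the i-th one are set to the
   coordinates of z0, the i-th one and its successors are those of z. *)
Definition freeze (R : realType) (n : nat) (z0 : 'rV[Cplx R]_n) (i : 'I_n)
    (z : 'rV[Cplx R]_n) : 'rV[Cplx R]_n :=
  \row_(k < n) (if (k < i)%N then z0 0 k else z 0 k).

(* d/dz_j is the derivative along the j-th vector of the standard basis. *)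
Definition KZ_eq_at (R : realType) (n : nat) (rho : int)
    (W : 'rV[Cplx R]_n -> 'M[Cplx R]_n) (j : 'I_n) (z : 'rV[Cplx R]_n) : Prop :=
  is_derive z (delta_mx 0 j) W (rho%:~R *: (KZ_A j z *m W z)).

(* The polynomial q may vanish at some points with distinct coordinates; no
   constraint is put on f there. *)
Definition rational_function (R : realType) (n : nat)
    (f : 'rV[Cplx R]_n -> Cplx R) : Prop :=
  exists p q : mpoly.mpoly n (Cplx R),
    q != 0 /\
    forall z, distinct_coords z -> mpoly.meval (fun k => z 0 k) q != 0 ->
      f z = mpoly.meval (fun k => z 0 k) p / mpoly.meval (fun k => z 0 k) q.

(* row_free W^T: the columns of W are linearly independent. *)
Definition fundamental_rational_solution (R : realType) (n : nat) (rho : int)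
    (W : 'rV[Cplx R]_n -> 'M[Cplx R]_n) : Prop :=
  [/\ forall z, distinct_coords z -> forall j, KZ_eq_at rho W j z,
      forall i j, rational_function (fun z => W z i j) &
      forall z, distinct_coords z -> row_free (W z)^T].

(* The order of the factors is that of the indices, 0 first. *)
Definition KZ_product (R : realType) (n : nat) (z0 : 'rV[Cplx R]_n)
    (W : 'I_n -> 'rV[Cplx R]_n -> 'M[Cplx R]_n) (z : 'rV[Cplx R]_n) :
    'M[Cplx R]_n :=
  \big[mulmx/1%:M]_(i < n) W i (freeze z0 i z).

(* Main.v *)
(* Write A_j = s_j - B_j, where s_j is the sum of the 1/(z_j - z_k) and B_j that
   of the (1 - P_{j,k})/(z_j - z_k) over k <> j. After factoring out a power of the
   Vandermonde product, the system becomes dU/dz_j = - rho B_j U, which is solved by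
   the integrals of p(t)^(-rho) / (t - z_k) dt with p(t) = prod_k (t - z_k).
   Reducing double poles modulo exact forms gives a contiguity relation between the
   parameters m and m + 1, that is, an explicit rational matrix S_m with
     d S_m / dz_j = m S_m B_j - (m + 1) B_j S_m.
   Up to the matrix of ones, S_m represents the bilinear form
     (f, g) |-> - sum_k (m f' g + (m + 1) f g')(z_k) / p'(z_k)
   on polynomials of degree < n, evaluated at the nodes. As the functional
   sum_k h(z_k) / p'(z_k) extracts the coefficient of t^(n-1), the form is
   antitriangular in the monomial basis, so S_m is invertible for m >= 0.
   Iterating S_m from rho = 0 solves the system for rho >= 0, and the inverse
   transpose solves it for -rho since A_j is symmetric. Uniqueness in the single
   variable z_i then identifies each W_i with a quotient of two values of the global
   solution V, and the product telescopes to V(z) V(z0)^-1. *)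
Require Import Defs.
From HB Require Import structures.
From mathcomp Require Import all_boot all_order all_algebra.
From mathcomp Require Import all_classical all_reals all_analysis.
From mathcomp Require Import perm ring zify.
From mathcomp Require mpoly.
Import (canonicals, coercions) mpoly.

Set Implicit Arguments.
Unset Strict Implicit.
Unset Printing Implicit Defensive.

Import Order.TTheory GRing.Theory Num.Theory.
Import numFieldNormedType.Exports.
Local Open Scope ring_scope.
Local Open Scope classical_set_scope.
From mathcomp Require Import complex.

(** * Lagrange interpolation at the coordinates of z *)

Lemma horner_deriv_prod_XsubC (F : fieldType) (I : Type) (r : seq I)
    (P : pred I) (a : I -> F) (x : F) : (forall i, P i -> x != a i) ->
  (\prod_(i <- r | P i) ('X - (a i)%:P))^`().[x] =
  \prod_(i <- r | P i) (x - a i) * \sum_(i <- r | P i) (x - a i)^-1.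
Proof.
move=> xa; elim: r => [|i r IH]; first by rewrite !big_nil derivC horner0 mulr0.
rewrite !big_cons; case: ifP => // Pi.
rewrite derivM hornerD !hornerM IH derivXsubC hornerC hornerXsubC mul1r.
rewrite horner_prod; under eq_bigr do rewrite hornerXsubC.
by rewrite mulrDr mulrAC divff ?subr_eq0 ?xa// mul1r mulrA.
Qed.

Section Nodes.
Variables (K : numFieldType) (n : nat).
Implicit Types (z : 'rV[K]_n) (i j k : 'I_n).

(** The barycentric weight 1 / p'(z_k) of Lagrange interpolation, where p(t) = prod_l (t - z_l). *)
Definition node_weight z k : K := \prod_(i < n | i != k) (z 0 k - z 0 i)^-1.

(** The scalar part s_k of A_k, and also the logarithmic derivative of [node_poly z k] at z_k. *)
Definition node_sum z k : K := \sum_(i < n | i != k) (z 0 k - z 0 i)^-1.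

(* The (k, i) entry is the residue at t = z_k of 1 / (p(t) (t - z_i)), where
   p(t) = prod_l (t - z_l). *)
Definition residue_mx z : 'M[K]_n :=
  \matrix_(k, i) if i == k then - (node_weight z k * node_sum z k)
                 else node_weight z k / (z 0 k - z 0 i).

(* The matrix S_m. Its part without the ones kills constant vectors on both sides;
   adding the ones makes it invertible without affecting the intertwining. *)
Definition shift_mx (m : nat) z : 'M[K]_n :=
  m%:R *: residue_mx z + m.+1%:R *: (residue_mx z)^T + const_mx 1.

Definition node_poly z k : {poly K} :=
  \prod_(i < n | i != k) ('X - (z 0 i)%:P).

(** The matrix B_j of the splitting A_j = s_j - B_j. *)
Definition exchange_mx j z : 'M[K]_n :=
  \sum_(k < n | k != j) (z 0 j - z 0 k)^-1 *: (1%:M - tperm_mx j k).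

(** The diagonal entry is minus the rest of its row at every [z], so this is an identity between
    functions and may be differentiated. *)
Lemma residue_mx_row_sum z k : \sum_i residue_mx z k i = 0.
Proof.
rewrite (bigD1 k)//= mxE eqxx /node_sum mulr_sumr addrC.
apply/eqP; rewrite subr_eq0; apply/eqP; apply: eq_bigr => i /negPf ik.
by rewrite mxE ik.
Qed.

Section Distinct.
Variable z : 'rV[K]_n.
Hypothesis hz : injective (fun k : 'I_n => z 0 k).

Lemma node_neq i k : i != k -> z 0 i - z 0 k != 0.
Proof. by rewrite subr_eq0 (inj_eq hz). Qed.

Lemma size_node_poly k : size (node_poly z k) = n.
Proof.
rewrite /node_poly -big_filter size_prod_XsubC size_filter.
have := cardC1 k; rewrite card_ord cardE size_filter.
under eq_count do rewrite inE.
move=> ->; by rewrite prednK// (leq_ltn_trans _ (ltn_ord k)).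
Qed.

Lemma node_poly_monic k : node_poly z k \is monic.
Proof. by rewrite monic_prod// => i _; rewrite monicXsubC. Qed.

Lemma horner_node_poly k i : i != k -> (node_poly z k).[z 0 i] = 0.
Proof.
by move=> ik; rewrite horner_prod (bigD1 i)//= hornerXsubC subrr mul0r.
Qed.

Lemma node_weight_neq0 k : node_weight z k != 0.
Proof.
by apply/prodf_neq0 => i ik; rewrite invr_neq0// node_neq// eq_sym.
Qed.

Lemma horner_node_polyx k : (node_poly z k).[z 0 k] = (node_weight z k)^-1.
Proof.
rewrite /node_weight prodfV invrK horner_prod.
by apply: eq_bigr => i _; rewrite hornerXsubC.
Qed.

Lemma poly_eq_on_nodes (p q : {poly K}) : (size p <= n)%N -> (size q <= n)%N ->
  (forall k, p.[z 0 k] = q.[z 0 k]) -> p = q.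
Proof.
move=> sp sq pq; apply/eqP; rewrite -subr_eq0; apply/eqP.
apply: (@roots_geq_poly_eq0 _ _ [seq z 0 k | k : 'I_n]).
- apply/allP => _ /mapP[k _ ->]; by rewrite rootE hornerD hornerN pq subrr.
- by rewrite map_inj_uniq ?enum_uniq.
- rewrite size_map size_enum_ord (leq_trans (size_polyD _ _))//.
  by rewrite size_polyN geq_max sp.
Qed.

Definition interpolant (v : 'I_n -> K) : {poly K} :=
  \sum_k (node_weight z k * v k) *: node_poly z k.

Lemma size_interpolant v : (size (interpolant v) <= n)%N.
Proof.
apply: (big_ind (fun p : {poly K} => size p <= n)%N); first by rewrite size_poly0.
  by move=> p q sp sq; rewrite (leq_trans (size_polyD _ _))// geq_max sp.
by move=> k _; rewrite (leq_trans (size_scale_leq _ _))// size_node_poly.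
Qed.

Lemma horner_interpolant v k : (interpolant v).[z 0 k] = v k.
Proof.
rewrite /interpolant horner_sum (bigD1 k)//= big1 ?addr0 => [|i ik].
  by rewrite hornerZ horner_node_polyx mulrAC divff ?mul1r// node_weight_neq0.
by rewrite hornerZ horner_node_poly ?mulr0// eq_sym.
Qed.

(** Compare top coefficients: [p] equals its interpolant, and each [node_poly] is monic of degree n
    - 1. *)
Lemma sum_node_weight (p : {poly K}) : (size p <= n)%N ->
  \sum_k node_weight z k * p.[z 0 k] = p`_n.-1.
Proof.
move=> sp.
have {2}-> : p = interpolant (fun k => p.[z 0 k]).
  apply: poly_eq_on_nodes => //; first exact: size_interpolant.
  by move=> k; rewrite horner_interpolant.
rewrite coef_sum; apply: eq_bigr => k _; rewrite coefZ.
have /monicP := node_poly_monic k.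
by rewrite /lead_coef size_node_poly => ->; rewrite mulr1.
Qed.

(** Write p = p(z_k) + (t - z_k) g with deg g < n - 1. The sum of w_i g(z_i) over all nodes
    vanishes, and its k-th term is w_k p'(z_k). *)
Lemma sum_node_weight_div (p : {poly K}) k : (size p <= n)%N ->
  \sum_(i < n | i != k) node_weight z i / (z 0 i - z 0 k) * (p.[z 0 i] - p.[z 0 k])
  = - (node_weight z k * p^`().[z 0 k]).
Proof.
move=> sp.
have /factor_theorem[g gE] : root (p - p.[z 0 k]%:P) (z 0 k).
  by rewrite rootE hornerD hornerN hornerC subrr.
have pE : p = g * ('X - (z 0 k)%:P) + p.[z 0 k]%:P by rewrite -gE subrK.
have n0 : (0 < n)%N by apply: leq_ltn_trans (ltn_ord k).
have sg : (size g <= n.-1)%N.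
  have [->|g0] := eqVneq g 0; first by rewrite size_poly0.
  have : (size (p - (p.[z 0 k])%:P)%R <= n)%N.
    rewrite (leq_trans (size_polyD _ _))// size_polyN geq_max sp.
    exact: leq_trans (size_polyC_leq1 _) n0.
  by rewrite gE size_Mmonic ?monicXsubC// size_XsubC addn2 /= -{1}(prednK n0).
have := sum_node_weight (leq_trans sg (leq_pred n)).
rewrite nth_default// (bigD1 k)//= => /eqP.
rewrite addrC addr_eq0 => /eqP gsum.
have -> : p^`().[z 0 k] = g.[z 0 k].
  rewrite pE derivD derivM derivXsubC derivC !hornerE; ring.
rewrite -gsum; apply: eq_bigr => i ik.
rewrite -mulrA; congr (_ * _).
rewrite pE !hornerE subrr mulr0 add0r addrK; field.
exact: node_neq.
Qed.

(* The case of [sum_node_weight_div] where p vanishes at all nodes but z_k. *)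
Lemma sum_node_weight_inv k :
  \sum_(i < n | i != k) node_weight z i / (z 0 i - z 0 k) =
  node_weight z k * node_sum z k.
Proof.
have := @sum_node_weight_div (node_poly z k) k.
rewrite size_node_poly leqnn => /(_ isT).
rewrite horner_deriv_prod_XsubC => [|i ik]; last by rewrite -subr_eq0 node_neq// eq_sym.
have -> : \prod_(i < n | i != k) (z 0 k - z 0 i) = (node_weight z k)^-1.
  by rewrite /node_weight prodfV invrK.
rewrite mulrA divff ?node_weight_neq0// mul1r horner_node_polyx => /eqP.
under eq_bigr => i ik do rewrite horner_node_poly// sub0r mulrN.
rewrite sumrN eqr_opp -mulr_suml => /eqP sE.
by rewrite /node_sum -sE mulrCA divff ?node_weight_neq0 ?mulr1.
Qed.

(** On values at the nodes the transposed residue matrix acts as a weighted d/dt, which allows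
    [shift_mx] to be studied on polynomials. The terms in p(z_k) are absorbed by the diagonal
    through [sum_node_weight_inv]. *)
Lemma residue_mxT_horner (p : {poly K}) k : (size p <= n)%N ->
  \sum_i residue_mx z i k * p.[z 0 i] = - (node_weight z k * p^`().[z 0 k]).
Proof.
move=> sp; rewrite -sum_node_weight_div//.
under [RHS]eq_bigr do rewrite mulrBr.
rewrite sumrB -mulr_suml sum_node_weight_inv (bigD1 k)//= mxE eqxx mulNr addrC.
congr (_ - _).
by apply: eq_bigr => i ik; rewrite mxE eq_sym (negPf ik).
Qed.

Lemma residue_mx_col_sum k : \sum_i residue_mx z i k = 0.
Proof.
have n0 : (0 < n)%N by apply: leq_ltn_trans (ltn_ord k).
have := @residue_mxT_horner 1%:P k.
rewrite size_polyC oner_eq0 => /(_ n0); rewrite derivC horner0 mulr0 oppr0 => sE.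
rewrite -[RHS]sE.
by apply: eq_bigr => i _; rewrite hornerC mulr1.
Qed.

End Distinct.
End Nodes.

(** * Invertibility of the shift matrices *)

Section Shift.
Variables (K : numFieldType) (n : nat) (z : 'rV[K]_n).
Hypothesis hz : injective (fun k : 'I_n => z 0 k).

(** Exchanging the sums in the [m] part lets the transposed residue matrix act on [f] there and on
    [g] in the [m.+1] part, each time as a derivative. *)
Lemma shift_mx_form m (f g : {poly K}) : (size f <= n)%N -> (size g <= n)%N ->
  \sum_k f.[z 0 k] * (\sum_i (m%:R * residue_mx z k i +
                              m.+1%:R * residue_mx z i k) * g.[z 0 i]) =
  - \sum_k node_weight z k *
       ((m%:R *: (f^`() * g) + m.+1%:R *: (f * g^`())).[z 0 k]).
Proof.
move=> sf sg; under eq_bigr do rewrite mulr_sumr.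
under eq_bigr => k _ do under eq_bigr do rewrite mulrDl mulrDr.
under eq_bigr do rewrite big_split/=.
rewrite big_split/= exchange_big/= -big_split/= -sumrN; apply: eq_bigr => k _.
transitivity (m%:R * g.[z 0 k] * (\sum_i residue_mx z i k * f.[z 0 i]) +
    m.+1%:R * f.[z 0 k] * (\sum_i residue_mx z i k * g.[z 0 i])).
  by rewrite !mulr_sumr; congr (_ + _); apply: eq_bigr => i _; ring.
by rewrite !residue_mxT_horner// hornerD !hornerZ !hornerM; ring.
Qed.

(** The interpolant [g] of [v] is orthogonal to all polynomials of degree < n. If it had degree d >
    0, pairing it with t^(n - d) would give, up to sign, m (n - d) + (m + 1) d times its leading
    coefficient, which is nonzero in characteristic 0. *)
Lemma shift_mx_kernel m (v : 'cV[K]_n) :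
  (m%:R *: residue_mx z + m.+1%:R *: (residue_mx z)^T) *m v = 0 ->
  exists a, forall k, v k 0 = a.
Proof.
move=> Gv.
pose g := interpolant z (fun k => v k 0).
have sg : (size g <= n)%N by exact: size_interpolant.
suff s1 : (size g <= 1)%N.
  exists (g`_0) => k; rewrite -(horner_interpolant hz (fun k => v k 0)) -/g.
  by rewrite {1}(size1_polyC s1) hornerC.
rewrite leqNgt; apply/negP => s1.
pose d := (size g).-1.
have d0 : (0 < d)%N by rewrite /d -subn1 subn_gt0.
have gd : size g = d.+1 by rewrite /d prednK// (leq_trans _ s1).
have dn : (d < n)%N by rewrite -gd.
have sX : (size ('X^(n - d) : {poly K}) <= n)%N.
  by rewrite size_polyXn ltn_subrL d0 (leq_ltn_trans _ dn).
(* The test polynomial 'X^(n - d) puts a nonzero multiple of the leading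
   coefficient of g in degree n.-1. *)
have := shift_mx_form m sX sg.
rewrite big1 => [|k _]; last first.
  have /matrixP/(_ k 0) := Gv; rewrite !mxE => Gvk.
  rewrite [X in _ * X](_ : _ = 0) ?mulr0// -[RHS]Gvk; apply: eq_bigr => i _.
  by rewrite !mxE /g horner_interpolant.
have nd : (0 < n - d)%N by rewrite subn_gt0.
move/esym/eqP; rewrite oppr_eq0 sum_node_weight//; last first.
  rewrite (leq_trans (size_polyD _ _))// geq_max.
  rewrite !(leq_trans (size_scale_leq _ _))//.
    rewrite (leq_trans (size_polyMleq _ _))// size_polyXn.
    have : (size (g^`())%R < d.+1)%N by rewrite -gd lt_size_deriv// -size_poly_gt0 gd.
    lia.
  rewrite derivXn -scaler_nat (leq_trans (size_polyMleq _ _))//.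
  have := size_scale_leq (n - d)%:R ('X^((n - d).-1) : {poly K}).
  rewrite size_polyXn; lia.
have -> : (m%:R *: (('X^(n - d))^`() * g) + m.+1%:R *: ('X^(n - d) * g^`()))`_n.-1 =
    (m * (n - d) + m.+1 * d)%:R * g`_d.
  rewrite coefD !coefZ derivXn [_ * g]mulrnAl coefMn !coefXnM.
  rewrite !ifN; [|by rewrite -leqNgt; lia..].
  have -> : (n.-1 - (n - d).-1 = d)%N by lia.
  have -> : (n.-1 - (n - d) = d.-1)%N by lia.
  by rewrite coef_deriv prednK// natrD !natrM; ring.
rewrite mulf_eq0 pnatr_eq0 => /orP[|]; first by apply/negP; lia.
by rewrite -/d -lead_coefE lead_coef_eq0 -size_poly_eq0 gd.
Qed.

(** Let S v = 0. The row of ones kills the part [G] of S without the ones, so n times the sum of the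
    entries of v is 0. Hence G v = 0, so v is constant with zero sum, that is, v = 0. *)
Lemma shift_mx_unit m : shift_mx m z \in unitmx.
Proof.
rewrite -unitmx_tr -row_free_unit -kermx_eq0; apply/eqP/row_matrixP => r.
rewrite row0; apply: trmx_inj; rewrite trmx0; set v := trmx _.
pose G := m%:R *: residue_mx z + m.+1%:R *: (residue_mx z)^T.
have Sv : shift_mx m z *m v = 0.
  by apply: trmx_inj; rewrite trmx_mul trmx0 /v trmxK -row_mul mulmx_ker row0.
clearbody v.
have G1 : const_mx 1 *m G = 0 :> 'rV[K]_n.
  apply/matrixP => a k; rewrite /G.
  move: (residue_mx_row_sum z k) (residue_mx_col_sum hz k).
  move: (residue_mx z) => X rX cX; rewrite !mxE.
  under eq_bigr do rewrite !mxE mul1r.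
  by rewrite big_split/= -!mulr_sumr rX cX !mulr0 addr0.
have JE : const_mx 1 = const_mx 1 *m (const_mx 1 : 'rV[K]_n) :> 'M[K]_n.
  by apply/matrixP => a k; rewrite !mxE big_ord1 !mxE mulr1.
have [k0 _|n0] := pickP [pred k : 'I_n | true]; last first.
  by apply/matrixP => k; have := n0 k.
have nK : n%:R != 0 :> K by rewrite pnatr_eq0 -lt0n (leq_ltn_trans _ (ltn_ord k0)).
have u1 : const_mx 1 *m v = 0 :> 'rV[K]_1.
  have : const_mx 1 *m (shift_mx m z *m v) = 0 :> 'rV[K]_1 by rewrite Sv mulmx0.
  rewrite mulmxA /shift_mx -/G mulmxDr G1 add0r JE mulmxA -mulmxA.
  have -> : (const_mx 1 : 'rV[K]_n) *m (const_mx 1 : 'cV[K]_n) = n%:R%:M.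
    apply/matrixP => a b; rewrite !ord1 !mxE eqxx.
    by under eq_bigr do rewrite !mxE mulr1; rewrite sumr_const card_ord.
  by rewrite mul_scalar_mx => /eqP; rewrite scaler_eq0 (negPf nK) => /eqP.
have [a va] : exists a, forall k, v k 0 = a.
  apply: (@shift_mx_kernel m); rewrite -/G; move: Sv.
  by rewrite /shift_mx -/G mulmxDl JE -mulmxA u1 mulmx0 addr0.
have : a *+ n = 0.
  have /matrixP/(_ 0 0) := u1; rewrite !mxE.
  by under eq_bigr do rewrite !mxE va mul1r; rewrite sumr_const card_ord.
move=> /eqP; rewrite -mulr_natl mulf_eq0 (negPf nK) => /eqP a0.
by apply/matrixP => k l; rewrite ord1 va a0 mxE.
Qed.
End Shift.

(** * Differentiation of the shift matrices *)

Section Exchange.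
Variables (K : numFieldType) (n : nat) (z : 'rV[K]_n).
Implicit Types (i j k : 'I_n).

Lemma exchange_mx_sym j : (exchange_mx j z)^T = exchange_mx j z.
Proof.
rewrite /exchange_mx linear_sum; apply: eq_bigr => k _.
by rewrite linearZ linearB /= trmx1 tr_tperm_mx.
Qed.

(** Only the columns j and l of M (1 - P_{j,l}) can be nonzero, so that for i != j the term l = i
    alone contributes. Column j is then determined by the vanishing row sums below. *)
Lemma mulmx_exchange (M : 'M[K]_n) j k i : i != j ->
  (M *m exchange_mx j z) k i = (M k i - M k j) / (z 0 j - z 0 i).
Proof.
move=> ij; rewrite /exchange_mx mulmx_sumr summxE (bigD1 i)//= big1 ?addr0.
  by rewrite -scalemxAr mxE mulmxBr mulmx1 -xcolE !mxE tpermR mulrC.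
move=> l /andP[lj li].
by rewrite -scalemxAr mxE mulmxBr mulmx1 -xcolE !mxE tpermD ?subrr ?mulr0// eq_sym.
Qed.

Lemma mulmx_exchange_row_sum (M : 'M[K]_n) j k :
  \sum_i (M *m exchange_mx j z) k i = 0.
Proof.
transitivity ((M *m exchange_mx j z *m (const_mx 1 : 'cV[K]_n)) k 0).
  by rewrite mxE; apply: eq_bigr => i _; rewrite [X in _ * X]mxE mulr1.
rewrite -mulmxA (_ : _ *m const_mx 1 = 0) ?mulmx0 ?mxE//.
rewrite /exchange_mx mulmx_suml big1// => l _.
rewrite -scalemxAl mulmxBl mul1mx -xrowE.
by apply/matrixP => a b; rewrite !mxE subrr mulr0.
Qed.

Lemma exchange_mx_const j : const_mx 1 *m exchange_mx j z = 0 :> 'M[K]_n.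
Proof.
rewrite -[RHS]trmx0 -[LHS]trmxK trmx_mul exchange_mx_sym trmx_const; congr trmx.
apply/matrixP => k l; rewrite !mxE -[RHS](mulmx_exchange_row_sum 1%:M j k) mul1mx.
by apply: eq_bigr => i _; rewrite mxE mulr1.
Qed.

Hypothesis hz : injective (fun k : 'I_n => z 0 k).

(** This is the cancellation behind [is_derive_shift_mx]. Both factors are symmetric, so it suffices
    that their product is symmetric. *)
Lemma residue_mx_exchange_comm j :
  (residue_mx z + (residue_mx z)^T) *m exchange_mx j z =
  exchange_mx j z *m (residue_mx z + (residue_mx z)^T).
Proof.
set Y := residue_mx z + _.
have Ysym k i : Y k i = Y i k by rewrite !mxE addrC.
have Yrow k : \sum_i Y k i = 0.
  rewrite (eq_bigr _ (fun i _ => mxE _ _ _ _)) big_split/=.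
  rewrite residue_mx_row_sum add0r -[RHS](residue_mx_col_sum hz k).
  by apply: eq_bigr => i _; rewrite mxE.
have YE k i : i != k ->
    Y k i = (node_weight z k - node_weight z i) / (z 0 k - z 0 i).
  move=> ik; rewrite /Y !mxE (negPf ik) eq_sym (negPf ik); field.
  by rewrite !node_neq// eq_sym.
suff TS k i : (Y *m exchange_mx j z) k i = (Y *m exchange_mx j z) i k.
  have YT : Y^T = Y by apply/matrixP => a b; rewrite mxE Ysym.
  rewrite -[RHS]trmxK trmx_mul YT exchange_mx_sym.
  by apply/matrixP => k i; rewrite [RHS]mxE TS.
(* Up to sign, both sides are the second divided difference of the weights at z_a,
   z_b, z_j. *)
have off a b : b != j -> a != j ->
    (Y *m exchange_mx j z) a b = (Y a b - Y j b) / (z 0 j - z 0 a).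
  move=> bj aj; rewrite mulmx_exchange//.
  have [->|ba] := eqVneq b a; first by rewrite (Ysym j).
  rewrite !YE//; last by rewrite eq_sym.
  by field; rewrite !node_neq// eq_sym.
(* The denominator in [off] does not depend on b, so it can be summed over b; the rows of the
   product and those of [Y] all sum to 0. *)
have offj a : a != j ->
    (Y *m exchange_mx j z) a j = (Y *m exchange_mx j z) j a.
  move=> aj; rewrite [RHS]mulmx_exchange// (Ysym j a).
  have /eqP := mulmx_exchange_row_sum Y j a.
  rewrite (bigD1 j)//= addr_eq0 => /eqP ->.
  rewrite (eq_bigr _ (fun b bj => off a b bj aj)) -mulr_suml sumrB -mulNr.
  congr (_ / _).
  have /eqP := Yrow a; rewrite (bigD1 j)//= addr_eq0 => /eqP ->.
  have /eqP := Yrow j; rewrite (bigD1 j)//= addr_eq0 => /eqP ->.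
  by rewrite opprB opprK addrC.
have [->|ij] := eqVneq i j.
  by have [->//|kj] := eqVneq k j; exact: offj.
have [->|kj] := eqVneq k j; first by rewrite offj.
rewrite off// mulmx_exchange//; congr (_ / _); congr (_ - _) => //.
Qed.
End Exchange.

(** * Derivatives of matrices, sums and products *)

Section MatrixDerive.
Variables (K : numFieldType) (V : normedModType K).
Implicit Types (x v : V).

Lemma is_derive_cvgP (W : normedModType K) (f : V -> W) x v (df : W) :
  is_derive x v f df <->
  h^-1 *: ((f \o shift x) (h *: v) - f x) @[h --> 0^'] --> df.
Proof.
split=> [[fd <-]|fd]; first exact: fd.
by apply: DeriveDef; [apply/cvg_ex; exists df|exact: cvg_lim fd].
Qed.

(** Balls of matrices are taken entrywise, and the finitely many neighbourhoods given by the entries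
    can be intersected. *)
Lemma is_derive_mxP m n (M : V -> 'M[K]_(m, n)) x v (dM : 'M[K]_(m, n)) :
  is_derive x v M dM <->
  forall i k, is_derive x v (fun y => M y i k) (dM i k).
Proof.
rewrite is_derive_cvgP; split=> [Md i k|Md].
  apply/is_derive_cvgP/cvg_ballP => e e0.
  move/cvg_ballP/(_ e e0) : Md; apply: filterS => h [_ /(_ i k)].
  by rewrite !mxE.
apply/cvg_ballP => e e0.
suff : \forall h \near 0^', forall ik : 'I_m * 'I_n,
    ball (dM ik.1 ik.2) e (h^-1 *: ((M \o shift x) (h *: v) - M x) ik.1 ik.2).
  by apply: filterS => h He; split=> // i k; have := He (i, k); rewrite !mxE.
apply: filter_forall => -[i k] /=.
have /is_derive_cvgP/cvg_ballP/(_ e e0) := Md i k.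
by apply: filterS => h; rewrite !mxE.
Qed.

Lemma is_derive_scalermx m n (f : V -> K) (M : V -> 'M[K]_(m, n)) x v df dM :
  is_derive x v f df -> is_derive x v M dM ->
  is_derive x v (fun y => f y *: M y) (df *: M x + f x *: dM).
Proof.
move=> fd /is_derive_mxP Md; apply/is_derive_mxP => i k.
rewrite (_ : (fun y => _) = f * (fun y => M y i k)); last first.
  by apply/funext => y; rewrite mxE.
by apply: is_derive_eq; rewrite !mxE addrC [_ *: df]mulrC.
Qed.

Lemma is_derive_mulmx m n p (M : V -> 'M[K]_(m, n)) (N : V -> 'M[K]_(n, p))
    x v dM dN :
  is_derive x v M dM -> is_derive x v N dN ->
  is_derive x v (fun y => M y *m N y) (dM *m N x + M x *m dN).
Proof.
move=> /is_derive_mxP Md /is_derive_mxP Nd; apply/is_derive_mxP => i k.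
rewrite (_ : (fun y => _) = \sum_l ((fun y => M y i l) * (fun y => N y l k))).
  apply: is_derive_eq (is_derive_sum (fun l => is_deriveM (Md i l) (Nd l k))) _.
  rewrite !mxE -big_split/=; apply: eq_bigr => l _.
  by rewrite addrC [dM i l * _]mulrC.
by apply/funext => y; rewrite mxE fct_sumE.
Qed.

Lemma is_derive_trmx m n (M : V -> 'M[K]_(m, n)) x v dM :
  is_derive x v M dM -> is_derive x v (fun y => (M y)^T) dM^T.
Proof.
move=> /is_derive_mxP Md; apply/is_derive_mxP => i k; rewrite mxE.
by rewrite (_ : (fun y => _) = fun y => M y k i)//; apply/funext => y; rewrite mxE.
Qed.

Lemma is_derive_sum_seq (I : Type) (r : seq I) (P : pred I)
    (f : I -> V -> K) (df : I -> K) x v :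
  (forall l, P l -> is_derive x v (f l) (df l)) ->
  is_derive x v (fun y => \sum_(l <- r | P l) f l y) (\sum_(l <- r | P l) df l).
Proof.
move=> fd; elim: r => [|l r IH].
  rewrite (_ : (fun y => _) = cst 0); last by apply/funext => y; rewrite big_nil.
  by rewrite big_nil; exact: is_derive_cst.
rewrite big_cons; case: ifP => Pi; last first.
  by rewrite (_ : (fun y => _) = fun y => \sum_(m <- r | P m) f m y)//;
    apply/funext => y; rewrite big_cons Pi.
rewrite (_ : (fun y => _) = f l + (fun y => \sum_(m <- r | P m) f m y)); last first.
  by apply/funext => y; rewrite big_cons Pi.
by apply: is_deriveD => //; exact: fd.
Qed.

(** With derivatives given as multiples f_i a_i, the Leibniz rule needs neither partial products nor
    a division by f_i. *)
Lemma is_derive_prod_log (I : Type) (r : seq I) (P : pred I) (f : I -> V -> K)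
    (a : I -> K) x v :
  (forall i, P i -> is_derive x v (f i) (f i x * a i)) ->
  is_derive x v (fun y => \prod_(i <- r | P i) f i y)
    ((\prod_(i <- r | P i) f i x) * \sum_(i <- r | P i) a i).
Proof.
move=> fd; elim: r => [|i r IH].
  rewrite (_ : (fun y => _) = cst 1); last by apply/funext => y; rewrite big_nil.
  by rewrite !big_nil mulr0; exact: is_derive_cst.
rewrite !big_cons; case: ifP => Pi; last first.
  by rewrite (_ : (fun y => _) = fun y => \prod_(j <- r | P j) f j y)//;
    apply/funext => y; rewrite big_cons Pi.
rewrite (_ : (fun y => _) = f i * (fun y => \prod_(j <- r | P j) f j y)); last first.
  by apply/funext => y; rewrite big_cons Pi.
have fid := fd _ Pi.
by apply: is_derive_eq; rewrite /GRing.scale/=; ring.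
Qed.

Lemma is_derive_inv_log (f : V -> K) x v df : f x != 0 ->
  is_derive x v f df -> is_derive x v (fun y => (f y)^-1) ((f x)^-1 * - (df / f x)).
Proof.
move=> fx0 [fd <-]; apply: DeriveDef; first exact: derivableV.
by rewrite deriveV// /GRing.scale/=; field.
Qed.

End MatrixDerive.

(** * Derivatives with respect to one coordinate *)

Section NodeDerive.
Variables (K : numFieldType) (n : nat).
Implicit Types (y : 'rV[K]_n) (i j k : 'I_n).

Definition vandermonde_prod y : K :=
  \prod_(i < n) \prod_(k < n | (i < k)%N) (y 0 i - y 0 k).

Variables (z : 'rV[K]_n) (j : 'I_n).
Hypothesis hz : injective (fun k : 'I_n => z 0 k).
Local Notation e_ := (delta_mx 0 j : 'rV[K]_n).

Lemma is_derive_coord k : is_derive z e_ (fun y => y 0 k) (k == j)%:R.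
Proof.
have /is_derive_mxP/(_ 0 k) := is_derive_id z e_.
by rewrite mxE eqxx.
Qed.

Lemma is_derive_node_sub i k :
  is_derive z e_ (fun y => y 0 k - y 0 i) ((k == j)%:R - (i == j)%:R).
Proof. by apply: is_deriveB; exact: is_derive_coord. Qed.

Lemma is_derive_node_inv i k : i != k ->
  is_derive z e_ (fun y => (y 0 k - y 0 i)^-1)
    ((z 0 k - z 0 i)^-1 * (((i == j)%:R - (k == j)%:R) / (z 0 k - z 0 i))).
Proof.
move=> ik; rewrite -[_ - (k == j)%:R]opprB mulNr.
apply: is_derive_inv_log; last exact: is_derive_node_sub.
by rewrite node_neq// eq_sym.
Qed.

Lemma is_derive_node_weight_diag :
  is_derive z e_ (fun y => node_weight y j) (- (node_weight z j * node_sum z j)).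
Proof.
apply: is_derive_eq.
  by apply: is_derive_prod_log => i ij; exact: is_derive_node_inv.
rewrite -mulrN; congr (_ * _); rewrite -sumrN; apply: eq_bigr => i ij.
by rewrite eqxx (negPf ij) sub0r mulN1r.
Qed.

Lemma is_derive_node_weight k : k != j ->
  is_derive z e_ (fun y => node_weight y k) (node_weight z k / (z 0 k - z 0 j)).
Proof.
move=> kj; have jk : j != k by rewrite eq_sym.
apply: is_derive_eq.
  by apply: is_derive_prod_log => i ik; exact: is_derive_node_inv.
congr (_ * _); rewrite (bigD1 j jk)/= big1 => [|i /andP[_ ij]].
  by rewrite eqxx (negPf kj) subr0 addr0 mul1r.
by rewrite (negPf ij) (negPf kj) subrr mul0r.
Qed.

Lemma is_derive_node_sum k : k != j ->
  is_derive z e_ (fun y => node_sum y k) ((z 0 k - z 0 j) ^- 2).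
Proof.
move=> kj; have jk : j != k by rewrite eq_sym.
apply: is_derive_eq.
  by apply: is_derive_sum_seq => i ik; exact: is_derive_node_inv.
rewrite (bigD1 j jk)/= big1 => [|i /andP[_ ij]].
  by rewrite eqxx (negPf kj) subr0 addr0 mul1r expr2 invfM.
by rewrite (negPf ij) (negPf kj) subrr mul0r mulr0.
Qed.

(** Differentiating 1 / (p(t) (t - z_i)) in z_j, for i != j, multiplies it by 1 / (t - z_j), and
    partial fractions yield a difference of columns j and i. This is what [off] checks entry by
    entry; column j follows as the rows sum to 0 on both sides. *)
Lemma is_derive_residue_mx :
  is_derive z e_ (@residue_mx K n) (- (residue_mx z *m exchange_mx j z)).
Proof.
have off k i : i != j -> is_derive z e_ (fun y => residue_mx y k i)
    ((residue_mx z k j - residue_mx z k i) / (z 0 j - z 0 i)).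
  move=> ij; rewrite (_ : (fun y => _) = fun y => if i == k
      then - (node_weight y k * node_sum y k)
      else node_weight y k / (y 0 k - y 0 i)); last first.
    by apply/funext => y; rewrite mxE.
  have [ik|ik] := eqVneq i k.
    have kj : k != j by rewrite -ik.
    apply: is_derive_eq.
      apply: is_deriveN; apply: is_deriveM.
        exact: is_derive_node_weight.
      exact: is_derive_node_sum.
    rewrite -ik !mxE eqxx eq_sym (negPf ij) /GRing.scale/=; field.
    by rewrite !node_neq// eq_sym.
  have [kj|kj] := eqVneq k j.
    rewrite kj; apply: is_derive_eq.
      apply: is_deriveM; first exact: is_derive_node_weight_diag.
      by apply: is_derive_node_inv.
    rewrite !mxE !eqxx (negPf ij) /GRing.scale/=; field.
    by rewrite !node_neq// eq_sym.
  apply: is_derive_eq.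
    apply: is_deriveM; first exact: is_derive_node_weight.
    exact: is_derive_node_inv.
  rewrite !mxE (negPf ij) (negPf ik) [j == k]eq_sym (negPf kj) /GRing.scale/=.
  by field; rewrite !node_neq// eq_sym.
apply/is_derive_mxP => k i; rewrite mxE.
have [->|ij] := eqVneq i j; last first.
  by rewrite mulmx_exchange// -mulNr opprB; exact: off.
rewrite (_ : (fun y => _) = - (fun y => \sum_(l | l != j) residue_mx y k l)).
  have /eqP := mulmx_exchange_row_sum z (residue_mx z) j k.
  rewrite (bigD1 j)//= addr_eq0 => /eqP ->; apply: is_deriveN.
  apply: is_derive_eq; first by apply: is_derive_sum_seq => l; exact: off.
  rewrite -sumrN; apply: eq_bigr => l lj.
  by rewrite mulmx_exchange// -mulNr opprB.
apply/funext => y; apply/eqP; rewrite -addr_eq0.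
by have /eqP := residue_mx_row_sum y k; rewrite (bigD1 j).
Qed.

(** With X the residue matrix, the termwise derivative differs from the claimed one by a multiple of
    the commutator of X + X^T with B_j, which is 0. The matrix of ones is killed by B_j on both
    sides. *)
Lemma is_derive_shift_mx m :
  is_derive z e_ (@shift_mx K n m)
    (m%:R *: (shift_mx m z *m exchange_mx j z) -
     m.+1%:R *: (exchange_mx j z *m shift_mx m z)).
Proof.
have dX := is_derive_residue_mx.
rewrite [X in is_derive _ _ X](_ : _ = (m%:R *: @residue_mx K n) +
  (m.+1%:R *: (fun y => (residue_mx y)^T)) + cst (const_mx 1)); last exact/funext.
have dXT := is_derive_trmx dX.
apply: (is_derive_eq (is_deriveD (is_deriveD (is_deriveZ m%:R dX)
  (is_deriveZ m.+1%:R dXT)) (is_derive_cst _ _ _))).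
have := residue_mx_exchange_comm hz j.
have JB := exchange_mx_const z j.
have BJ : exchange_mx j z *m const_mx 1 = 0 :> 'M[K]_n.
  by rewrite -[LHS]trmxK trmx_mul exchange_mx_sym trmx_const JB trmx0.
have -> : (- (residue_mx z *m exchange_mx j z))^T =
    - (exchange_mx j z *m (residue_mx z)^T).
  by rewrite linearN/= trmx_mul exchange_mx_sym.
have -> : shift_mx m z =
    m%:R *: residue_mx z + m.+1%:R *: (residue_mx z)^T + const_mx 1 by [].
move: (residue_mx z) (exchange_mx j z) JB BJ => X B JB BJ.
rewrite !mulmxDl !mulmxDr JB BJ !addr0 -!scalemxAl -!scalemxAr.
move: (X *m B) (X^T *m B) (B *m X) (B *m X^T) => P Q P' Q' /matrixP PQ.
apply/matrixP => a b; have := PQ a b; rewrite !mxE.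
move: (P a b) (Q a b) (P' a b) (Q' a b) => p q p' q' /eqP.
rewrite -subr_eq => /eqP <-; ring.
Qed.

Lemma is_derive_vandermonde_prod :
  is_derive z e_ vandermonde_prod (vandermonde_prod z * node_sum z j).
Proof.
pose a i k : K := ((i == j)%:R - (k == j)%:R) / (z 0 i - z 0 k).
apply: is_derive_eq.
  apply: (@is_derive_prod_log _ _ _ _ _ _ (fun i => \sum_(k < n | (i < k)%N) a i k)).
  move=> i _; apply: is_derive_prod_log => k ik.
  apply: is_derive_eq; first exact: is_derive_node_sub.
  by rewrite mulrCA mulfV ?mulr1// node_neq// neq_ltn ik.
congr (_ * _).
(* Separates the pairs with j as smaller index from those with j as larger index; in the latter the
   two signs cancel. *)
transitivity (\sum_(i < n) \sum_(k < n | (i < k)%N) ((i == j)%:R / (z 0 i - z 0 k)) +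
   \sum_(k < n) \sum_(i < n | (i < k)%N) ((k == j)%:R / (z 0 k - z 0 i))).
  rewrite [X in _ = _ + X](exchange_big_dep predT)//= -big_split/=.
  apply: eq_bigr => i _; rewrite -big_split/=; apply: eq_bigr => k ik.
  by rewrite /a; field; rewrite !node_neq// neq_ltn ik ?orbT.
rewrite [X in X + _](bigD1 j)//= [X in _ + X + _]big1 ?addr0 => [|i ij]; last first.
  by rewrite big1// => k _; rewrite (negPf ij) mul0r.
rewrite [X in _ + X](bigD1 j)//= [X in _ + (_ + X)]big1 ?addr0 => [|i ij]; last first.
  by rewrite big1// => k _; rewrite (negPf ij) mul0r.
rewrite eqxx /node_sum [RHS](bigID (fun k : 'I_n => (j < k)%N))/=.
congr (_ + _); apply: eq_big => [k|k _]; rewrite ?mul1r//.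
  by rewrite andbC; case: ltngtP => //= jk; rewrite -val_eqE/= ?gtn_eqF// jk eqxx.
by rewrite -leqNgt [RHS]andbC -val_eqE/= ltn_neqAle andbC.
Qed.
End NodeDerive.

(** * Rational solutions for all integers rho *)

Section InverseDerive.
Variables (K : numFieldType) (V : normedModType K).
Implicit Types (x v : V).

Lemma derivable_sum_seq (I : Type) (r : seq I) (f : I -> V -> K) x v :
  (forall i, derivable (f i) x v) ->
  derivable (fun y => \sum_(i <- r) f i y) x v.
Proof.
by move=> fd; have [] := @is_derive_sum_seq _ _ _ r xpredT _ _ _ _
  (fun i _ => derivableP (fd i)).
Qed.

Lemma derivable_prod_seq (I : Type) (r : seq I) (f : I -> V -> K) x v :
  (forall i, derivable (f i) x v) ->
  derivable (fun y => \prod_(i <- r) f i y) x v.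
Proof.
move=> fd; elim: r => [|i r IH].
  rewrite (_ : (fun y => _) = cst 1); last by apply/funext => y; rewrite big_nil.
  exact: derivable_cst.
rewrite (_ : (fun y => _) = f i * (fun y => \prod_(l <- r) f l y)).
  exact: derivableM.
by apply/funext => y; rewrite big_cons.
Qed.

Lemma derivable_det n (M : V -> 'M[K]_n) x v :
  (forall i k, derivable (fun y => M y i k) x v) ->
  derivable (fun y => \det (M y)) x v.
Proof.
move=> Md; apply: derivable_sum_seq => s.
apply: derivableM; first exact: derivable_cst.
by apply: derivable_prod_seq => i; exact: Md.
Qed.

Lemma derivable_adj n (M : V -> 'M[K]_n) x v :
  (forall i k, derivable (fun y => M y i k) x v) ->
  forall i k, derivable (fun y => (\adj (M y)) i k) x v.
Proof.
move=> Md i k.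
rewrite (_ : (fun y => _) = cst ((-1) ^+ (k + i)) *
    (fun y => \det (row' k (col' i (M y))))); last first.
  by apply/funext => y; rewrite mxE.
apply: derivableM; first exact: derivable_cst.
apply: derivable_det => a b.
by rewrite (_ : (fun y => _) = fun y => M y (lift k a) (lift i b))//;
  apply/funext => y; rewrite !mxE.
Qed.

(* Unlike [invmx M], it is given by a single formula, also near a point where M is
   not known to stay invertible. *)
Definition cramer_inv n (M : 'M[K]_n) : 'M[K]_n := (\det M)^-1 *: \adj M.

Lemma cramer_invE n (M : 'M[K]_n) : M \in unitmx -> cramer_inv M = invmx M.
Proof. by rewrite /invmx => ->. Qed.

(** Cramer's formula gives differentiability. The value then comes from the product rule for
    [cramer_inv (M y) *m M y], whose derivative at x is 0. *)
Lemma is_derive_cramer_inv n (M : V -> 'M[K]_n) x v (dM : 'M[K]_n) :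
  M x \in unitmx -> is_derive x v M dM ->
  is_derive x v (fun y => cramer_inv (M y))
    (- (invmx (M x) *m dM *m invmx (M x))).
Proof.
move=> Mu dMx; have Md := (is_derive_mxP _ _ _ _).1 dMx.
have Mder i k : derivable (fun y => M y i k) x v by case: (Md i k).
have det0 : \det (M x) != 0 by rewrite -unitfE -unitmxE.
have detd := derivableP (derivable_det Mder).
have detVd := @is_derive_inv_log _ _ (fun y => \det (M y)) _ _ _ det0 detd.
have adjd : is_derive x v (fun y => \adj (M y))
    (\matrix_(i, k) 'D_v (fun y => (\adj (M y)) i k) x).
  apply/is_derive_mxP => i k; rewrite mxE; exact/derivableP/derivable_adj.
have Nd := is_derive_scalermx detVd adjd.
set dN := (X in is_derive _ _ _ X) in Nd.
suff -> : - (invmx (M x) *m dM *m invmx (M x)) = dN by [].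
have e1 := is_derive_mulmx Nd dMx.
(* This quotient is 1 only where the determinant is nonzero, so its derivative is computed and not
   read off from constancy. *)
have cd : is_derive x v (fun y => (\det (M y))^-1 * \det (M y)) 0.
  apply: (is_derive_eq (is_deriveM detVd detd)).
  by rewrite /GRing.scale/=; field.
have e2 : is_derive x v (fun y => ((\det (M y))^-1 *: \adj (M y)) *m M y) 0.
  rewrite (_ : (fun y => _) = fun y => ((\det (M y))^-1 * \det (M y)) *: 1%:M).
    apply: (is_derive_eq (is_derive_scalermx cd (is_derive_cst (1%:M : 'M[K]_n) x v))).
    by rewrite scaler0 addr0 scale0r.
  by apply/funext => y; rewrite -scalemxAl mul_adj_mx !scale_scalar_mx mulr1.
have : dN *m M x + invmx (M x) *m dM = 0.
  rewrite -cramer_invE//.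
  by rewrite -(@derive_val _ _ _ _ _ _ _ e2) (@derive_val _ _ _ _ _ _ _ e1).
move/eqP; rewrite addr_eq0 => /eqP dNM.
by rewrite -[dN](mulmxK Mu) dNM mulNmx.
Qed.
End InverseDerive.

(** * Global solutions built from the shift matrices *)

Section Solution.
Variables (K : numFieldType) (n : nat).
Implicit Types (z : 'rV[K]_n) (j : 'I_n).

Definition KZ_mx j z : 'M[K]_n := node_sum z j *: 1%:M - exchange_mx j z.

Fixpoint KZ_pos (m : nat) z : 'M[K]_n :=
  if m is m'.+1 then vandermonde_prod z *: (shift_mx m' z *m KZ_pos m' z)
  else 1%:M.

(** [Negz m] stands for -(m + 1), hence the index [m.+1]. *)
Definition KZ_sol (rho : int) z : 'M[K]_n :=
  match rho with
  | Posz m => KZ_pos m z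
  | Negz m => (cramer_inv (KZ_pos m.+1 z))^T
  end.

Variables (z : 'rV[K]_n).
Hypothesis hz : injective (fun k : 'I_n => z 0 k).

Lemma KZ_mx_sym j : (KZ_mx j z)^T = KZ_mx j z.
Proof. by rewrite linearB/= linearZ/= trmx1 exchange_mx_sym. Qed.

Lemma vandermonde_prod_neq0 : vandermonde_prod z != 0.
Proof.
by apply/prodf_neq0 => i _; apply/prodf_neq0 => k ik; rewrite node_neq// neq_ltn ik.
Qed.

Lemma KZ_pos_unit m : KZ_pos m z \in unitmx.
Proof.
elim: m => [|m IH]; first exact: unitmx1.
rewrite /= unitmxZ ?unitfE ?vandermonde_prod_neq0//.
by rewrite unitmx_mul shift_mx_unit.
Qed.

Lemma KZ_sol_unit rho : KZ_sol rho z \in unitmx.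
Proof.
case: rho => m /=; first exact: KZ_pos_unit.
by rewrite unitmx_tr -/(KZ_pos m.+1 z) cramer_invE ?unitmx_inv KZ_pos_unit.
Qed.

(** The Vandermonde factor raises the scalar part from m s_j to (m + 1) s_j. The term m S_m B_j from
    the derivative of S_m cancels the one from [KZ_pos m], and -(m + 1) B_j is left. *)
Lemma is_derive_KZ_pos j m :
  is_derive z (delta_mx 0 j) (KZ_pos m) (m%:R *: (KZ_mx j z *m KZ_pos m z)).
Proof.
elim: m => [|m IH]; first by rewrite scale0r; exact: is_derive_cst.
have dS := is_derive_shift_mx j hz m.
have dD := is_derive_vandermonde_prod j hz.
have := is_derive_scalermx dD (is_derive_mulmx dS IH).
move/is_derive_eq; apply.
rewrite /= /KZ_mx; move: (shift_mx m z) (exchange_mx j z) (KZ_pos m z) => S B W.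
rewrite !(mulmxBl, mulmxBr, mulmxDl, mulmxDr) -!(scalemxAl, scalemxAr) !mul1mx !mulmxA.
rewrite mulmxBr -scalemxAr mulmxA.
move: (S *m W) (S *m B *m W) (B *m S *m W) => P Q T.
by apply/matrixP => a b; rewrite !mxE; ring.
Qed.

(** For rho < 0, the inverse of the positive solution V has derivative rho V^-1 A_j, and transposing
    brings the symmetric A_j back to the left. *)
Lemma is_derive_KZ_sol j rho :
  is_derive z (delta_mx 0 j) (KZ_sol rho) (rho%:~R *: (KZ_mx j z *m KZ_sol rho z)).
Proof.
case: rho => m; first exact: is_derive_KZ_pos.
have := is_derive_trmx
  (is_derive_cramer_inv (KZ_pos_unit m.+1) (is_derive_KZ_pos j m.+1)).
move/is_derive_eq; apply.
rewrite -scalemxAr -scalemxAl mulmxA mulmxK ?KZ_pos_unit//.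
rewrite [KZ_sol _ _]/KZ_sol cramer_invE ?KZ_pos_unit//.
by rewrite NegzE mulrNz scaleNr linearN linearZ/= trmx_mul KZ_mx_sym.
Qed.

End Solution.

(** * Rationality of the solutions *)

Section Rational.
Variables (R : realType) (n : nat).
Implicit Types (f g : 'rV[Cplx R]_n -> Cplx R).

(* Requiring a denominator without zeros at points with distinct coordinates makes
   this class stable under inversion of the functions that do not vanish there. *)
Definition regular_rational f : Prop :=
  exists p q : mpoly.mpoly n (Cplx R), forall z, distinct_coords z ->
    mpoly.meval (fun k => z 0 k) q != 0 /\
    f z = mpoly.meval (fun k => z 0 k) p / mpoly.meval (fun k => z 0 k) q.

Lemma regular_rational_cst (c : Cplx R) : regular_rational (fun=> c).
Proof.
exists (mpoly.mpolyC n c), 1 => z _.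
by rewrite mpoly.mevalC mpoly.meval1 oner_neq0 divr1.
Qed.

Lemma regular_rational_coord (k : 'I_n) : regular_rational (fun z => z 0 k).
Proof.
exists (mpoly.mpolyX (Cplx R) (mpoly.mnm1 k)), 1 => z _.
by rewrite mpoly.mevalXU mpoly.meval1 oner_neq0 divr1.
Qed.

Lemma regular_rationalD f g : regular_rational f -> regular_rational g ->
  regular_rational (fun z => f z + g z).
Proof.
move=> [p [q fE]] [p' [q' gE]]; exists (p * q' + p' * q), (q * q') => z hz.
have [q0 ->] := fE z hz; have [q'0 ->] := gE z hz.
rewrite mpoly.mevalD !mpoly.mevalM mulf_neq0//; split=> //.
by field; rewrite q0 q'0.
Qed.

Lemma regular_rationalM f g : regular_rational f -> regular_rational g ->
  regular_rational (fun z => f z * g z).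
Proof.
move=> [p [q fE]] [p' [q' gE]]; exists (p * p'), (q * q') => z hz.
have [q0 ->] := fE z hz; have [q'0 ->] := gE z hz.
rewrite !mpoly.mevalM mulf_neq0//; split=> //.
by field; rewrite q0 q'0.
Qed.

Lemma regular_rationalN f : regular_rational f -> regular_rational (fun z => - f z).
Proof.
move=> fr; rewrite (_ : (fun z => _) = fun z => -1 * f z).
  exact/regular_rationalM/fr/regular_rational_cst.
by apply/funext => z; rewrite mulN1r.
Qed.

Lemma regular_rationalV f : regular_rational f ->
  (forall z, distinct_coords z -> f z != 0) -> regular_rational (fun z => (f z)^-1).
Proof.
move=> [p [q fE]] f0; exists q, p => z hz.
have [q0 fzE] := fE z hz; have := f0 z hz; rewrite fzE invf_div.
by rewrite mulf_eq0 negb_or => /andP[].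
Qed.

Lemma eq_regular_rational f g : (forall z, distinct_coords z -> f z = g z) ->
  regular_rational f -> regular_rational g.
Proof.
by move=> fg [p [q fE]]; exists p, q => z hz; rewrite -fg//; exact: fE.
Qed.

Lemma regular_rational_sum (I : Type) (r : seq I) (P : pred I)
    (F : I -> 'rV[Cplx R]_n -> Cplx R) :
  (forall i, P i -> regular_rational (F i)) ->
  regular_rational (fun z => \sum_(i <- r | P i) F i z).
Proof.
move=> Fr; elim: r => [|i r IH].
  by apply: eq_regular_rational (regular_rational_cst 0) => z _; rewrite big_nil.
have [Pi|/negPf Pi] := boolP (P i).
  apply: eq_regular_rational (regular_rationalD (Fr i Pi) IH) => z _.
  by rewrite big_cons Pi.
by apply: eq_regular_rational IH => z _; rewrite big_cons Pi.
Qed.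

Lemma regular_rational_prod (I : Type) (r : seq I) (P : pred I)
    (F : I -> 'rV[Cplx R]_n -> Cplx R) :
  (forall i, P i -> regular_rational (F i)) ->
  regular_rational (fun z => \prod_(i <- r | P i) F i z).
Proof.
move=> Fr; elim: r => [|i r IH].
  by apply: eq_regular_rational (regular_rational_cst 1) => z _; rewrite big_nil.
have [Pi|/negPf Pi] := boolP (P i).
  apply: eq_regular_rational (regular_rationalM (Fr i Pi) IH) => z _.
  by rewrite big_cons Pi.
by apply: eq_regular_rational IH => z _; rewrite big_cons Pi.
Qed.

(** The point [z0] witnesses that the denominator is not the zero polynomial. *)
Lemma regular_rationalW f (z0 : 'rV[Cplx R]_n) : distinct_coords z0 ->
  regular_rational f -> rational_function f.
Proof.
move=> hz0 [p [q fE]]; exists p, q; split=> [|z hz _]; last by case: (fE z hz).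
by apply: contraNneq (proj1 (fE z0 hz0)) => ->; rewrite mpoly.meval0.
Qed.

Definition regular_rational_mx m p (M : 'rV[Cplx R]_n -> 'M[Cplx R]_(m, p)) :=
  forall i k, regular_rational (fun z => M z i k).

Lemma regular_rational_mulmx m p q (M : 'rV[Cplx R]_n -> 'M[Cplx R]_(m, p))
    (N : 'rV[Cplx R]_n -> 'M[Cplx R]_(p, q)) :
  regular_rational_mx M -> regular_rational_mx N ->
  regular_rational_mx (fun z => M z *m N z).
Proof.
move=> Mr Nr i k.
apply: (@eq_regular_rational (fun z => \sum_l M z i l * N z l k)).
  by move=> z _; rewrite mxE.
by apply: regular_rational_sum => l _; apply: regular_rationalM.
Qed.

Lemma regular_rational_det m (M : 'rV[Cplx R]_n -> 'M[Cplx R]_m) :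
  regular_rational_mx M -> regular_rational (fun z => \det (M z)).
Proof.
move=> Mr; apply: regular_rational_sum => s _; apply: regular_rationalM.
  exact: regular_rational_cst.
by apply: regular_rational_prod.
Qed.

Lemma regular_rational_cramer_inv m (M : 'rV[Cplx R]_n -> 'M[Cplx R]_m) :
  (forall z, distinct_coords z -> M z \in unitmx) ->
  regular_rational_mx M -> regular_rational_mx (fun z => cramer_inv (M z)).
Proof.
move=> Mu Mr i k; apply: (@eq_regular_rational (fun z =>
    (\det (M z))^-1 * ((-1) ^+ (k + i) * \det (row' k (col' i (M z)))))).
  by move=> z _; rewrite !mxE.
apply: regular_rationalM; [apply: regular_rationalV|apply: regular_rationalM].
- exact: regular_rational_det.
- by move=> z /Mu; rewrite unitmxE unitfE.
- exact: regular_rational_cst.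
- apply: regular_rational_det => a b.
  by apply: eq_regular_rational (Mr (lift k a) (lift i b)) => z _; rewrite !mxE.
Qed.

Lemma regular_rational_node_inv (i k : 'I_n) : i != k ->
  regular_rational (fun z => (z 0 k - z 0 i)^-1).
Proof.
move=> ik; apply: regular_rationalV.
  apply: regular_rationalD; first exact: regular_rational_coord.
  exact/regular_rationalN/regular_rational_coord.
by move=> z hz; rewrite node_neq// eq_sym.
Qed.

Lemma regular_rational_residue_mx : regular_rational_mx (@residue_mx (Cplx R) n).
Proof.
have wr k : regular_rational (fun z => node_weight z k).
  by apply: regular_rational_prod => i ik; exact: regular_rational_node_inv.
have sr k : regular_rational (fun z => node_sum z k).
  by apply: regular_rational_sum => i ik; exact: regular_rational_node_inv.
move=> k i; have [ik|ik] := eqVneq i k.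
  apply: eq_regular_rational (regular_rationalN (regular_rationalM (wr k) (sr k))).
  by move=> z _; rewrite mxE ik eqxx.
apply: eq_regular_rational (regular_rationalM (wr k) (regular_rational_node_inv ik)).
by move=> z _; rewrite mxE (negPf ik).
Qed.

Lemma regular_rational_KZ_pos m : regular_rational_mx (@KZ_pos (Cplx R) n m).
Proof.
elim: m => [|m IH] i k /=.
  by apply: eq_regular_rational (regular_rational_cst ((1%:M : 'M[Cplx R]_n) i k)).
apply: (@eq_regular_rational (fun z =>
   vandermonde_prod z * ((shift_mx m z *m KZ_pos m z) i k))).
  by move=> z _; rewrite [RHS]mxE.
apply: regular_rationalM.
  apply: regular_rational_prod => a _; apply: regular_rational_prod => b _.
  apply: regular_rationalD; first exact: regular_rational_coord.
  exact/regular_rationalN/regular_rational_coord.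
apply: regular_rational_mulmx IH _ _ => a b.
apply: (@eq_regular_rational (fun z =>
   m%:R * residue_mx z a b + m.+1%:R * residue_mx z b a + 1)).
  by move=> z _; rewrite /shift_mx; move: (residue_mx z) => X; rewrite !mxE.
apply: regular_rationalD; last exact: regular_rational_cst.
by apply: regular_rationalD; apply: regular_rationalM;
  [exact: regular_rational_cst|exact: regular_rational_residue_mx
  |exact: regular_rational_cst|exact: regular_rational_residue_mx].
Qed.

Lemma regular_rational_KZ_sol rho : regular_rational_mx (@KZ_sol (Cplx R) n rho).
Proof.
case: rho => m; first exact: regular_rational_KZ_pos.
move=> i k.
have Mu (z : 'rV[Cplx R]_n) : distinct_coords z -> KZ_pos m.+1 z \in unitmx.
  by move/KZ_pos_unit.
have := regular_rational_cramer_inv Mu (@regular_rational_KZ_pos m.+1) k i.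
by apply: eq_regular_rational => z _; rewrite [RHS]mxE.
Qed.
End Rational.

(** * Uniqueness in one variable *)

Section Constancy.
Variables (R : realType).
Local Notation C := (Cplx R).

(** Here [p] stands for Re or Im. A real increment h is the complex increment h c along [v], and [p]
    is contracting, so the real difference quotient is at most |c| times the complex one. *)
Lemma is_derive0_real_part (V : normedModType C) (f : V -> C) (x v : V) (c : C)
    (p : C -> R) (t : R) :
  {morph p : a b / a - b} -> (forall a, ((`|p a|)%:C)%C <= `|a|) ->
  is_derive (x + ((t%:C)%C * c) *: v) v f 0 ->
  is_derive t 1 (fun s : R => p (f (x + ((s%:C)%C * c) *: v))) 0.
Proof.
move=> pB ple.
have p0 : p 0 = 0 by rewrite -(subrr 0) pB subrr.
have [->|c0] := eqVneq c 0.
  move=> _; rewrite (_ : (fun s => _) = cst (p (f x))); first exact: is_derive_cst.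
  by apply/funext => s; rewrite mulr0 scale0r addr0.
set y := x + _ => /is_derive_cvgP/cvgrPdist_lt fd.
apply/is_derive_cvgP/cvgrPdist_lt => e e0.
have nc0 : 0 < `|c| by rewrite normr_gt0.
have eC0 : 0 < (e%:C)%C / `|c| by rewrite divr_gt0// ltcR.
have [d /= d0 dP] := fd _ eC0.
have dc0 : 0 < d / `|c| by rewrite divr_gt0.
(* The radius is a positive element of C; its real part is the radius used in R. *)
have dcE : ((Re (d / `|c|))%:C)%C = d / `|c| by apply: RRe_real; exact: gtr0_real.
have r0 : 0 < Re (d / `|c|) by rewrite -ltcR dcE.
exists (Re (d / `|c|)) => //.
move=> h /=; rewrite sub0r normrN => hd h0.
have hC0 : (h%:C)%C != 0 :> C by rewrite -(inj_eq (@complexI R)) in h0.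
have normhC : `|(h%:C)%C| = ((`|h|)%:C)%C :> C.
  by rewrite normc_def/= expr0n addr0 sqrtr_sqr.
have := dP ((h%:C)%C * c).
rewrite /= sub0r normrN normrM normhC -ltr_pdivlMr// -dcE ltcR => /(_ hd).
rewrite mulf_neq0// => /(_ isT).
rewrite !sub0r !normrN normrZ normfV normrM normhC => lt.
have shE : x + (((h%:A + t)%:C)%C * c) *: v = ((h%:C)%C * c) *: v + y.
  by rewrite /y addrCA -scalerDl -mulrDl -rmorphD/= [h%:A]mulr1.
rewrite -ltcR normrM normfV/= shE -/y -pB rmorphM/= fmorphV/=.
apply: le_lt_trans (_ : ((`|h|)%:C)%C^-1 * `|f (((h%:C)%C * c) *: v + y) - f y| < _).
  by rewrite ler_wpM2l ?ple// invr_ge0 lecR.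
by move: lt; rewrite invfM mulrAC ltr_pdivlMr// divfK ?normr_eq0.
Qed.

Lemma is_derive0_segment_real_part (V : normedModType C) (f : V -> C) (x v : V)
    (c : C) (p : C -> R) :
  {morph p : a b / a - b} -> (forall a, ((`|p a|)%:C)%C <= `|a|) ->
  (forall t : R, 0 <= t <= 1 -> is_derive (x + ((t%:C)%C * c) *: v) v f 0) ->
  p (f (x + c *: v)) = p (f x).
Proof.
move=> pB ple fd.
pose g (s : R) := p (f (x + ((s%:C)%C * c) *: v)).
have gd (t : R) : t \in `[0, 1]%R -> is_derive t 1 g 0.
  by rewrite in_itv/= => t01; exact: (is_derive0_real_part pB ple (fd t t01)).
have g0 (t : R) : t \in `]0, 1[%R -> is_derive t 1 g 0.
  by move=> t01; apply: gd; exact: subset_itv_oo_cc.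
have gc : {within `[0, 1], continuous g}.
  by apply: derivable_within_continuous => t /gd[].
have [t _] := MVT_segment (ler01 : 0 <= 1 :> R) g0 gc.
by rewrite /g mul0r mul1r mul0r scale0r addr0 => /eqP; rewrite subr_eq0 => /eqP.
Qed.

(** The mean value theorem holds for real functions, so real and imaginary parts are treated
    separately. *)
Lemma is_derive0_segment (V : normedModType C) (f : V -> C) (x v : V) (c : C) :
  (forall t : R, 0 <= t <= 1 -> is_derive (x + ((t%:C)%C * c) *: v) v f 0) ->
  f (x + c *: v) = f x.
Proof.
move=> fd.
have ReE : Re (f (x + c *: v)) = Re (f x).
  apply: is_derive0_segment_real_part fd => [[a b] [a' b']//|a].
  exact: normc_ge_Re.
have ImE : Im (f (x + c *: v)) = Im (f x).
  apply: is_derive0_segment_real_part fd => [[a b] [a' b']//|a].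
  (* The bound for Im follows from the one for Re, as Re (a i) = - Im a. *)
  have := normc_ge_Re (a * 'i%C); rewrite ReiNIm normrN normrM.
  by rewrite (_ : `|'i%C| = 1 :> C) ?mulr1// normc_def/= expr0n add0r expr1n sqrtr1.
by apply/eqP; rewrite eq_complex ReE ImE !eqxx.
Qed.
End Constancy.

Lemma invmx_telescope (K : fieldType) (n m : nat) (F : nat -> 'M[K]_n) :
  (forall i, F i \in unitmx) ->
  \big[mulmx/1%:M]_(i < m) (F i *m invmx (F i.+1)) = F 0 *m invmx (F m).
Proof.
move=> Fu; elim: m => [|m IH]; first by rewrite big_ord0 mulmxV.
rewrite -[LHS]/(\prod_(i < m.+1) (F i *m invmx (F i.+1))) big_ord_recr/=.
rewrite [X in X * _](_ : _ = F 0 *m invmx (F m)); last exact: IH.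
by rewrite -[LHS]/(_ *m _) mulmxA mulmxKV.
Qed.

(** * Comparison of the local factors with the global solution *)

Section Main.
Variables (R : realType) (n : nat).
Local Notation C := (Cplx R).
Implicit Types (z : 'rV[C]_n).

Lemma KZ_AE (j : 'I_n) z : KZ_A j z = KZ_mx j z.
Proof.
rewrite /KZ_A /KZ_mx /node_sum /exchange_mx scaler_suml -sumrB.
by apply: eq_bigr => k _; rewrite scalerBr subKr.
Qed.

Lemma KZ_eq_at_KZ_sol rho (j : 'I_n) z :
  distinct_coords z -> KZ_eq_at rho (KZ_sol rho) j z.
Proof. by move=> hz; rewrite /KZ_eq_at KZ_AE; exact: is_derive_KZ_sol. Qed.

Lemma near_distinct_coords z0 :
  distinct_coords z0 -> \forall z \near z0, distinct_coords (z : 'rV[C]_n).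
Proof.
move=> hz0; pose P (ik : 'I_n * 'I_n) : set 'rV[C]_n :=
  [set z | ik.1 != ik.2 -> z 0 ik.1 - z 0 ik.2 != 0].
have : \forall z \near z0, forall ik, P ik z.
  apply: (@filter_forall _ _ P _ (nbhs_filter z0)) => -[i k]; rewrite /P /=.
  have [_|ik] := eqVneq i k; first exact: nearW.
  have : (z : 'rV[C]_n) 0 i - z 0 k @[z --> z0] --> z0 0 i - z0 0 k.
    exact: cvgB (@coord_continuous C 1 n 0 i z0) (@coord_continuous C 1 n 0 k z0).
  move=> /cvgr_neq0/(_ (node_neq hz0 ik)); exact: filterS.
apply: filterS => z zd i k zik; apply/eqP; apply: contraT => /(zd (i, k)) /=.
by rewrite zik subrr eqxx.
Qed.

(** A natural index can reach n, where every variable is frozen; below n this is [freeze]. *)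
Definition freeze_nat z0 (m : nat) z : 'rV[C]_n :=
  \row_k (if (k < m)%N then z0 0 k else z 0 k).

(** Balls are products of coordinate balls, each of which contains its centre. *)
Lemma ball_freeze z0 m z e : ball z0 e z -> ball z0 e (freeze_nat z0 m z).
Proof.
move=> [e0 ze]; split=> // i k; rewrite mxE (ord1 i).
by case: ifP => _; [exact: ballxx|exact: ze].
Qed.

(** With V = [KZ_sol rho], the function V^-1 U has derivative 0 along the segment, both solving the
    same equation, so it keeps its initial value V(z)^-1. *)
Lemma KZ_normalized_unique rho (U : 'rV[C]_n -> 'M[C]_n) (j : 'I_n) (c : C) z :
  (forall t : R, 0 <= t <= 1 -> let y := z + ((t%:C)%C * c) *: delta_mx 0 j in
     distinct_coords y /\ KZ_eq_at rho U j y) ->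
  U z = 1%:M ->
  U (z + c *: delta_mx 0 j) =
  KZ_sol rho (z + c *: delta_mx 0 j) *m invmx (KZ_sol rho z).
Proof.
move=> hy Uz1.
pose F y := cramer_inv (KZ_sol rho y) *m U y.
have Fd (t : R) : 0 <= t <= 1 ->
    is_derive (z + ((t%:C)%C * c) *: delta_mx 0 j) (delta_mx 0 j) F 0.
  move=> /hy []; set y := _ + _ => hd Uy; have Vu := KZ_sol_unit hd rho.
  have := is_derive_mulmx (is_derive_cramer_inv Vu (KZ_eq_at_KZ_sol rho j hd)) Uy.
  move/is_derive_eq; apply.
  rewrite cramer_invE// -scalemxAr -!scalemxAl mulmxA mulmxK// -scalemxAr mulmxA.
  by rewrite -scaleNr -scalemxAl scaleNr addNr.
have Fc : F (z + c *: delta_mx 0 j) = F z.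
  apply/matrixP => a b.
  apply: (@is_derive0_segment R _ (fun y => F y a b)) => t t01.
  by have /is_derive_mxP/(_ a b) := Fd t t01; rewrite mxE.
have z_dist : distinct_coords z.
  have [] := hy 0; first by rewrite lexx ler01.
  by rewrite rmorph0 mul0r scale0r addr0.
have zc_dist : distinct_coords (z + c *: delta_mx 0 j).
  have [] := hy 1; first by rewrite lexx ler01.
  by rewrite rmorph1 mul1r.
have FE y : distinct_coords y -> F y = invmx (KZ_sol rho y) *m U y.
  by move=> /KZ_sol_unit/(_ rho)/cramer_invE VE; rewrite /F VE.
have Fc' := etrans (esym (FE _ zc_dist)) (etrans Fc (FE _ z_dist)).
rewrite -[LHS](mulKVmx (KZ_sol_unit zc_dist rho)); congr (_ *m _).
by rewrite Fc' Uz1 mulmx1.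
Qed.
End Main.

Theorem theorem3p1 (R : realType) (n : nat) (rho : int) (z0 : 'rV[Cplx R]_n)
    (hz0 : distinct_coords z0)
    (W : 'I_n -> 'rV[Cplx R]_n -> 'M[Cplx R]_n)
    (hW : forall i : 'I_n, \forall z \near z0,
        KZ_eq_at rho (W i) i (freeze z0 i z))
    (hI : forall i : 'I_n, \forall z \near z0,
        (z : 'rV[Cplx R]_n) 0 i = z0 0 i -> W i (freeze z0 i z) = 1%:M) :
  exists V : 'rV[Cplx R]_n -> 'M[Cplx R]_n,
    fundamental_rational_solution rho V /\
    \forall z \near z0, KZ_product z0 W z = V z.
Proof.
(* Finitely many neighbourhoods are intersected, so that a single ball serves all indices. *)
have z0_near : \forall z \near z0, [/\ distinct_coords z,
    forall i, KZ_eq_at rho (W i) i (freeze z0 i z) &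
    forall i, (z : 'rV[Cplx R]_n) 0 i = z0 0 i -> W i (freeze z0 i z) = 1%:M].
  have h1 := near_distinct_coords hz0.
  have h2 := @filter_forall _ _ (fun i z => KZ_eq_at rho (W i) i (freeze z0 i z))
    _ (nbhs_filter z0) hW.
  have h3 := @filter_forall _ _
    (fun i (z : 'rV[Cplx R]_n) => z 0 i = z0 0 i -> W i (freeze z0 i z) = 1%:M)
    _ (nbhs_filter z0) hI.
  by apply: filterS2 h1 (filterI h2 h3) => z z1 [z2 z3]; split.
have /nbhs_ballP[e e0 he] := z0_near.
(* A constant invertible factor on the right preserves solutions; this one is what the telescoping
   product leaves. *)
pose V z := KZ_sol rho z *m invmx (KZ_sol rho z0).
have V_unit z : distinct_coords z -> V z \in unitmx.
  by move=> zd; rewrite unitmx_mul unitmx_inv; apply/andP; split; exact: KZ_sol_unit.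
exists V; split.
  split=> [z hz j|i j|z hz].
  - have := is_derive_mulmx (KZ_eq_at_KZ_sol rho j hz)
      (is_derive_cst (invmx (KZ_sol rho z0)) z (delta_mx 0 j)).
    by move/is_derive_eq; apply; rewrite mulmx0 addr0 -scalemxAl mulmxA.
  - apply: (regular_rationalW hz0); apply: regular_rational_mulmx i j.
      exact: regular_rational_KZ_sol.
    by move=> a b; exact: regular_rational_cst.
  - by rewrite row_free_unit unitmx_tr V_unit.
apply/nbhs_ballP; exists e => // z ze.
pose F m := KZ_sol rho (freeze_nat z0 m z).
have Fu m : F m \in unitmx.
  by apply: KZ_sol_unit; have [] := he _ (ball_freeze m ze).
(* The points behind [F i] and [F i.+1] differ only in the i-th coordinate, z_i against z_{i,0};
   uniqueness is applied along the segment joining them. *)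
have FW (i : 'I_n) : W i (freeze z0 i z) = F i *m invmx (F i.+1).
  have fzE : freeze z0 i z =
      freeze_nat z0 i.+1 z + (z 0 i - z0 0 i) *: delta_mx 0 i.
    apply/rowP => k; rewrite !mxE eqxx /=; have [->|ki] := eqVneq k i.
      by rewrite ltnn ltnS leqnn mulr1 addrC subrK.
    by rewrite mulr0 addr0 ltnS [(k <= i)%N]leq_eqVlt val_eqE (negPf ki).
  (* The hypotheses speak of [freeze z0 i] at points near [z0], so each point of the segment is
     presented as the freezing of a point [zt t] of the ball. *)
  pose zt (t : R) : 'rV[Cplx R]_n := \row_k (if k == i
    then z0 0 i + (t%:C)%C * (z 0 i - z0 0 i) else z 0 k).
  have ztE t : freeze z0 i (zt t) =
      freeze_nat z0 i.+1 z + ((t%:C)%C * (z 0 i - z0 0 i)) *: delta_mx 0 i.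
    apply/rowP => k; rewrite !mxE eqxx /=; have [->|ki] := eqVneq k i.
      by rewrite ltnn ltnS leqnn mulr1.
    by rewrite mulr0 addr0 ltnS [(k <= i)%N]leq_eqVlt val_eqE (negPf ki).
  have ztb t : 0 <= t <= 1 -> ball z0 e (zt t).
    move=> /andP[t0 t1]; case: ze => _ ze; split=> // a k; rewrite (ord1 a) mxE.
    case: eqP => [->|_]; last exact: ze.
    rewrite -ball_normE /ball_/= opprD addNKr normrN normrM.
    have := ze 0 i; rewrite -ball_normE /ball_/= distrC; apply: le_lt_trans.
    by rewrite ler_piMl// ger0_norm lecR.
  rewrite [in RHS](_ : F i = KZ_sol rho (freeze_nat z0 i.+1 z +
      (z 0 i - z0 0 i) *: delta_mx 0 i)); last by rewrite -fzE.
  rewrite fzE; apply: KZ_normalized_unique.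
    move=> t t01 y; rewrite /y -ztE; split.
      by have [] := he _ (ball_freeze i (ztb t t01)).
    by have [_ hWi _] := he _ (ztb t t01).
  (* At t = 0 the i-th coordinate is that of [z0], and the normalization of [W i] applies. *)
  have t0 : 0 <= (0 : R) <= 1 by rewrite lexx ler01.
  have [_ _ /(_ i)] := he _ (ztb 0 t0).
  by rewrite ztE !mxE eqxx rmorph0 mul0r scale0r !addr0; exact.
have -> : KZ_product z0 W z = F 0%N *m invmx (F n).
  by rewrite -(invmx_telescope n Fu); apply: eq_bigr => i _; exact: FW.
have -> : F 0%N = KZ_sol rho z.
  by rewrite /F; congr (KZ_sol _ _); apply/rowP => k; rewrite mxE.
suff -> : F n = KZ_sol rho z0 by [].
by rewrite /F; congr (KZ_sol _ _); apply/rowP => k; rewrite mxE ltn_ord.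
Qed.
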